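(* Let $\alpha(n),\beta(n)\in\mathbb{C}$ ($n\ge1$) satisfy $\alpha(n)\beta(n)=n$ for all $n\ge1$, and let $h(n)$, $n\in\mathbb{Z}$, be the associated Heisenberg operators on $y\mathbb{C}[x_1,x_2,x_3,\dots]$. Then the operator $$L(-1)=\frac12\sum_{k\in\mathbb{Z}}h(-1-k)h(k)$$ on $y\mathbb{C}[x_1,x_2,x_3,\dots]$ is identical to the operator $\mathcal{D}$ with, and only with, both $\alpha(n)=\frac{1}{(n-1)!}$ and $\beta(n)=n!$ for all $n\ge1$.
   Context: $y,x_1,x_2,\dots$ are commuting formal variables. The operators $h(n)$ on the space $y\mathbb{C}[x_1,x_2,x_3,\dots]$ are: $h(n)=\alpha(-n)x_{-n}$ (multiplication) for $n<0$; $h(n)=\beta(n)\frac{\partial}{\partial x_n}$ for $n>0$; $h(0)=y\frac{\partial}{\partial y}$ (which is the identity operator on this space). The condition $\alpha(n)\beta(n)=n$ is exactly what makes these a representation of the Heisenberg Lie algebra, $[h(m),h(n)]=m\delta_{m+n,0}$. $\mathcal{D}$ is the operator on $y\mathbb{C}[x_1,x_2,\dots]$ which is the (restriction of the) derivation determined by $\mathcal{D}y=yx_1$ and $\mathcal{D}x_j=x_{j+1}$ for $j\ge1$; that is, $\mathcal{D}=x_1y\frac{\partial}{\partial y}+\sum_{k\ge1}x_{k+1}\frac{\partial}{\partial x_k}$. *)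

(* Defs.v *)
From HB Require Import structures.
From mathcomp Require Import all_boot all_algebra.
From mathcomp Require Import finmap.
From mathcomp Require Import boolp classical_sets cardinality fsbigop.
From mathcomp Require Import monalg.

Set Implicit Arguments.
Unset Strict Implicit.
Unset Printing Implicit Defensive.

Import GRing.Theory.

Local Open Scope classical_set_scope.
Local Open Scope ring_scope.

(* F[y, x_1, x_2, ...]: the formal variables are indexed by nat, index 0
   standing for y and index n >= 1 for x_n. *)
Notation polyYX F := {malg F[{cmonom nat}]}.

Section Operators.
Context {F : fieldType}.
Implicit Types (f g p : polyYX F) (i k n : nat).

Definition vy : polyYX F := << ucm 0%N >>.

(* Meant for n >= 1 only. *)
Definition vx n : polyYX F := << ucm n >>.

(* When m i = 0 the truncated quotient of m by the i-th variable is junk, but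
   its coefficient is 0. *)
Definition pderiv i f : polyYX F :=
  \sum_(m <- msupp f) << (m i)%:R * f@_m *g divcm m (ucm i) >>.

Definition free_of_y p : Prop := forall m, m \in msupp p -> m 0%N = 0%N.

(* The space y F[x_1, x_2, ...]. *)
Definition yFx : set (polyYX F) := [set vy * p | p in free_of_y].

Definition heis (alpha beta : nat -> F) (n : int) f : polyYX F :=
  match n with
  | Negz m => alpha m.+1 *: (vx m.+1 * f)
  | Posz 0 => vy * pderiv 0 f
  | Posz m.+1 => beta m.+1 *: pderiv m.+1 f
  end.

(* The sum runs over the k whose term is nonzero; there are finitely many of
   them by Lm1_finite_support. *)
Definition Lm1 (alpha beta : nat -> F) f : polyYX F :=
  2^-1 *: \sum_(k \in [set: int]) heis alpha beta (-1 - k) (heis alpha beta k f).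

(* The infinite sum is finite on each f by pderiv_bound; calD is the derivation
   with the prescribed values on the variables by calDD, calDZ, calDM, calD_vy
   and calD_vx. *)
Definition calD f : polyYX F :=
  vx 1 * vy * pderiv 0 f
  + \sum_(k \in [set k : nat | (1 <= k)%N]) vx k.+1 * pderiv k f.

End Operators.

(* The lemmas below go through an arbitrary monomial type or algebra because
   failing unifications of ring operations on {malg F[{cmonom nat}]} blow up. *)

Lemma malg_ind (F : fieldType) (K : monomType) (P : {malg F[K]} -> Prop) :
  (forall f g, P f -> P g -> P (f + g)) -> P 0 ->
  (forall c m, P << c *g m >>) -> forall f, P f.
Proof. by move=> PD P0 PU f; rewrite (monalgE f); apply: big_ind. Qed.

Lemma malgUM (F : fieldType) (K : monomType) (c1 c2 : F) (m1 m2 : K) :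
  << c1 *g m1 >> * << c2 *g m2 >> = << c1 * c2 *g mmul m1 m2 >> :> {malg F[K]}.
Proof. by rewrite malgM_def fgmulUU. Qed.

Lemma malgZU (F : fieldType) (K : choiceType) (c a : F) (m : K) :
  c *: << a *g m >> = << c * a *g m >> :> {malg F[K]}.
Proof. by apply/malgP => m'; rewrite mcoeffZ !mcoeffU mulrnAr. Qed.

Lemma malgU_eq (F : fieldType) (K : choiceType) n (a b : F) (m m' : K) :
  n%:R * a = b -> ((0 < n)%N -> m = m') ->
  << n%:R * a *g m >> = << b *g m' >> :> {malg F[K]}.
Proof. by move=> <-; case: n => [_|n ->] //; rewrite mul0r !monalgU0. Qed.

Lemma malg_leibniz (F : fieldType) (K : conomType)
    (D : {malg F[K]} -> {malg F[K]}) (w : K -> nat) (q : K -> K) :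
  (forall f g, D (f + g) = D f + D g) ->
  (forall c m, D << c *g m >> = << (w m)%:R * c *g q m >>) ->
  (forall m1 m2, w (mmul m1 m2) = (w m1 + w m2)%N) ->
  (forall m1 m2, (0 < w m1)%N -> q (mmul m1 m2) = mmul (q m1) m2) ->
  forall f g, D (f * g) = D f * g + f * D g.
Proof.
move=> DD DU wM qM f g.
have D0 : D 0 = 0 by apply: (addrI (D 0)); rewrite -DD !addr0.
elim/malg_ind: f => [f1 f2 h1 h2||c1 m1].
- by rewrite mulrDl !DD h1 h2 2!mulrDl addrACA.
- by rewrite mul0r D0 !mul0r addr0.
elim/malg_ind: g => [g1 g2 h1 h2||c2 m2].
- by rewrite mulrDr !DD h1 h2 2!mulrDr addrACA.
- by rewrite mulr0 D0 !mulr0 addr0.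
rewrite malgUM !DU !malgUM wM natrD mulrDl monalgUD.
congr (_ + _); apply: malgU_eq => [|wm]; first by rewrite mulrA.
- exact: qM.
- by rewrite mulrCA.
- by rewrite mulmC qM // mulmC.
Qed.

Section LocallyFinite.
Context (F : fieldType) (A : comAlgType F) (d : nat -> A -> A) (b : nat -> A)
  (a : A).
Hypothesis dD : forall k f g, d k (f + g) = d k f + d k g.
Hypothesis dZ : forall k c f, d k (c *: f) = c *: d k f.
Hypothesis dM : forall k f g, d k (f * g) = d k f * g + f * d k g.
Hypothesis d_bound : forall f, exists N, forall k, (N <= k)%N -> d k f = 0.

Let E f := \sum_(k \in [set k : nat | (1 <= k)%N]) b k * d k f.

Lemma locfin_sumE N f : (forall k, (N <= k)%N -> d k f = 0) ->
  E f = \sum_(1 <= k < N) b k * d k f.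
Proof.
move=> dN; rewrite fsbig_seq ?iota_uniq //; symmetry; apply: fsbig_widen.
  by move=> k /=; rewrite mem_index_iota => /andP[].
move=> k /= [k1 /negP]; rewrite mem_index_iota k1 -leqNgt /= => /dN ->.
by rewrite mulr0.
Qed.

Lemma locfin_bound2 f g : exists N,
  (forall k, (N <= k)%N -> d k f = 0) /\ (forall k, (N <= k)%N -> d k g = 0).
Proof.
have [[M hM] [N hN]] := (d_bound f, d_bound g).
by exists (maxn M N); split=> k; rewrite geq_max => /andP[/hM ? /hN ?].
Qed.

Lemma locfin_sumD f g : E (f + g) = E f + E g.
Proof.
have [N [hf hg]] := locfin_bound2 f g.
rewrite !(@locfin_sumE N) -?big_split //=; last first.
  by move=> k kN; rewrite dD hf ?hg ?addr0.
by apply: eq_bigr => k _; rewrite dD mulrDr.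
Qed.

Lemma locfin_sumZ c f : E (c *: f) = c *: E f.
Proof.
have [N hf] := d_bound f.
rewrite !(@locfin_sumE N) ?scaler_sumr //; last first.
  by move=> k kN; rewrite dZ hf ?scaler0.
by apply: eq_bigr => k _; rewrite dZ scalerAr.
Qed.

Lemma locfin_sumM f g : E (f * g) = E f * g + f * E g.
Proof.
have [N [hf hg]] := locfin_bound2 f g.
rewrite !(@locfin_sumE N) //; last first.
  by move=> k kN; rewrite dM hf ?hg // mul0r mulr0 addr0.
rewrite mulr_suml mulr_sumr -big_split /=; apply: eq_bigr => k _.
by rewrite dM mulrDr mulrA [f * (_ * _)]mulrCA.
Qed.

Let D f := a * d 0 f + E f.

Lemma locfin_derD f g : D (f + g) = D f + D g.
Proof. by rewrite /D dD locfin_sumD mulrDr addrACA. Qed.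

Lemma locfin_derZ c f : D (c *: f) = c *: D f.
Proof. by rewrite /D dZ locfin_sumZ -scalerAr -scalerDr. Qed.

Lemma locfin_derM f g : D (f * g) = D f * g + f * D g.
Proof.
rewrite /D dM locfin_sumM !mulrDr mulrDl addrACA mulrA.
by congr (_ + (_ + _)); rewrite mulrCA.
Qed.

Lemma locfin_derX i (z : A) : (forall k, d k z = (k == i)%:R) ->
  D z = if i is 0 then a else b i.
Proof.
move=> hz; rewrite /D (@locfin_sumE i.+1) => [|k]; last first.
  by rewrite hz => ki; rewrite gtn_eqF.
rewrite hz; case: i hz => [|i] hz; first by rewrite big_geq // mulr1 addr0.
rewrite big_nat_recr //= hz eqxx mulr0 mulr1 add0r.
by rewrite big_nat big1 ?add0r // => k /andP[_ ki]; rewrite hz ltn_eqF // mulr0.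
Qed.

End LocallyFinite.

Section OperatorLemmas.
Context {F : fieldType}.
Implicit Types (f g : polyYX F) (i k n : nat).

Lemma pderivEw i f (d : {fset cmonom nat}) : (msupp f `<=` d)%fset ->
  pderiv i f = \sum_(m <- d) << (m i)%:R * f@_m *g divcm m (ucm i) >>.
Proof.
move=> le; rewrite /pderiv (big_fset_incl _ le) //= => m _ /mcoeff_outdom ->.
by rewrite mulr0 monalgU0.
Qed.

Lemma pderivU i (c : F) (m : cmonom nat) :
  pderiv i << c *g m >> = << (m i)%:R * c *g divcm m (ucm i) >>.
Proof.
by rewrite (pderivEw i (@msuppU_le _ _ m c)) big_seq_fset1 mcoeffUU.
Qed.

Lemma pderivD i f g : pderiv i (f + g) = pderiv i f + pderiv i g.
Proof.
pose d := (msupp (f + g)%R `|` (msupp f `|` msupp g))%fset.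
rewrite (@pderivEw i _ d) ?fsubsetUl // (@pderivEw i f d); last first.
  by rewrite /d fsetUCA fsubsetUl.
rewrite (@pderivEw i g d); last by rewrite /d fsetUA fsubsetUr.
rewrite -big_split /=; apply: eq_bigr => m _.
by rewrite mcoeffD mulrDr monalgUD.
Qed.

Lemma pderivZ i (c : F) f : pderiv i (c *: f) = c *: pderiv i f.
Proof.
rewrite (@pderivEw i (c *: f) (msupp f) (msuppZ_le c f)) /pderiv scaler_sumr.
by apply: eq_bigr => m _; rewrite malgZU mcoeffZ mulrCA.
Qed.

Lemma pderivM i f g : pderiv i (f * g) = pderiv i f * g + f * pderiv i g.
Proof.
move: f g; apply: (malg_leibniz (pderivD i) (pderivU i)) => [m1 m2|m1 m2 m1i].
  exact: mulcmE.
apply/eqP/cmP => j; rewrite divcmE !mulcmE divcmE ucmE.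
by case: eqP => [<-|_]; rewrite ?subn0 // addnBAC.
Qed.

Lemma pderiv_vx i n : pderiv i (vx n) = (i == n)%:R :> polyYX F.
Proof.
rewrite pderivU mulr1 ucmE eq_sym; case: eqP => [->|_]; last first.
  exact: monalgU0.
suff -> : divcm (ucm n) (ucm n) = mone by [].
by apply/eqP/cmP => j; rewrite divcmE subnn onecmE.
Qed.

Lemma pderiv_bound f : exists N, forall k, (N <= k)%N -> pderiv k f = 0.
Proof.
elim/malg_ind: f => [f g [M hM] [N hN]||c m].
- exists (maxn M N) => k; rewrite geq_max => /andP[/hM Mk /hN Nk].
  by rewrite pderivD Mk Nk addr0.
- by exists 0%N => k _; rewrite /pderiv msupp0 big_seq_fset0.
exists (\max_(i <- finsupp m) i).+1 => k mk; rewrite pderivU.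
suff -> : m k = 0%N by rewrite mul0r monalgU0.
apply/eqP; rewrite cmE_eq0; apply: contraTN mk => km.
by rewrite -leqNgt (big_fsetD1 k) //= leq_maxl.
Qed.

Lemma calDD f g : calD (f + g) = calD f + calD g.
Proof. exact: (locfin_derD (A := polyYX F) _ _ pderivD pderiv_bound). Qed.

Lemma calDZ (c : F) f : calD (c *: f) = c *: calD f.
Proof. exact: (locfin_derZ (A := polyYX F) _ _ pderivZ pderiv_bound). Qed.

Lemma calDM f g : calD (f * g) = calD f * g + f * calD g.
Proof. exact: (locfin_derM (A := polyYX F) _ _ pderivM pderiv_bound). Qed.

Lemma calD_vy : calD vy = vy * vx 1 :> polyYX F.
Proof.
rewrite [RHS]mulrC.
exact: (locfin_derX (A := polyYX F) _ _ (pderiv_vx ^~ 0%N)).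
Qed.

Lemma calD_vx j : (1 <= j)%N -> calD (vx j) = vx j.+1 :> polyYX F.
Proof.
case: j => // j _.
exact: (locfin_derX (A := polyYX F) _ _ (pderiv_vx ^~ j.+1)).
Qed.

Lemma heis0 (alpha beta : nat -> F) (n : int) : heis alpha beta n 0 = 0.
Proof.
have p0 i : pderiv i (0 : polyYX F) = 0 by rewrite /pderiv msupp0 big_seq_fset0.
case: n => [[|n]|n] /=; rewrite ?p0.
- exact: mulr0.
- exact: scaler0.
- by rewrite mulr0; exact: scaler0.
Qed.

Lemma Lm1_finite_support (alpha beta : nat -> F) f :
  finite_set [set k : int | heis alpha beta (-1 - k) (heis alpha beta k f) != 0].
Proof.
have [N hN] := pderiv_bound f.
apply: (@sub_finite_set _ _ ((Posz @` `I_N.+1) `|` (Negz @` `I_N.+2))); last first.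
  by rewrite finite_setU; split; apply: finite_image; exact: finite_II.
move=> [k|k] /= nz; [left|right]; exists k => //=.
  apply: contraNltn nz; case: k => // k Nk; apply/eqP.
  by rewrite (hN k.+1 (ltnW Nk)) scaler0 heis0.
apply: contraNltn nz; case: k => [|k] // Nk; apply/eqP.
rewrite pderivZ pderivM pderiv_vx (hN k.+1 (ltnW (ltnW Nk))).
by rewrite ltn_eqF // mul0r mulr0 addr0 2!scaler0.
Qed.

End OperatorLemmas.

(* Main.v *)
(* Since [h(-1-k)] and [h(k)] commute, folding the sum at [-1/2] gives
     [L(-1) = alpha(1) x_1 y d/dy + \sum_(k >= 1) alpha(k+1) beta(k) x_{k+1} d/dx_k].
   Evaluating at [y] and at [y x_k] shows that this is [D] on [yF[x_1, ...]] iff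
   [alpha(1) = 1] and [alpha(k+1) beta(k) = 1] for all [k >= 1]; together with
   [alpha(n) beta(n) = n] this recursion determines [alpha] and [beta]. *)

Require Import Defs.
From mathcomp Require Import all_boot all_algebra.
From mathcomp Require Import finmap complex.
From mathcomp Require Import boolp classical_sets fsbigop reals.
From mathcomp Require Import monalg.

Import GRing.Theory.

Local Open Scope classical_set_scope.
Local Open Scope ring_scope.

(** * Symmetric sums over the integers, and identities in general algebras *)

(** As [Negz k] is [-1-k], the second hypothesis is symmetry about -1/2: the negative half of the
    sum repeats the nonnegative half. *)
Lemma fsbig_int (V : zmodType) (g : int -> V) N :
  (forall k : nat, (N <= k)%N -> g (Posz k) = 0) ->
  (forall k : nat, g (Negz k) = g (Posz k)) ->
  \sum_(k \in [set: int]) g k = (\sum_(0 <= k < N) g (Posz k)) *+ 2.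
Proof.
move=> gN gneg; have inj_Posz : injective Posz by move=> ? ? [].
have inj_Negz : injective Negz by move=> ? ? [].
have out (c : nat -> int) i : c i \notin map c (index_iota 0 N) -> (N <= i)%N.
  by rewrite leqNgt; apply: contraNN => iN; rewrite map_f // mem_index_iota.
rewrite (fsbigE (map Posz (index_iota 0 N) ++ map Negz (index_iota 0 N))) //=.
- under eq_bigl do rewrite in_setT.
  by rewrite big_cat !big_map /= mulr2n; under [X in _ + X = _]eq_bigr do rewrite gneg.
- rewrite cat_uniq !map_inj_uniq // iota_uniq andbT /=.
  by apply/hasPn => _ /mapP[k _ ->]; apply/mapP => -[].
move=> k _; rewrite mem_cat negb_or => /andP[].
case: k => i iP iN; first exact/gN/out/iP.
by rewrite gneg; apply/gN/out/iN.
Qed.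

Lemma mulr_scaleCA (F : fieldType) (A : comAlgType F) (a : F) (x y z : A) :
  y * (a *: (x * z)) = a *: (x * (y * z)).
Proof. by rewrite -scalerAr mulrCA. Qed.

Lemma scale_mulrCA (F : fieldType) (A : algType F) (a b : F) (x z : A) :
  b *: (a *: (x * z)) = a *: (x * (b *: z)).
Proof. by rewrite -scalerAr !scalerA mulrC. Qed.

Lemma scale_mulr_scale (F : fieldType) (A : algType F) (a b : F) (x z : A) :
  a *: (x * (b *: z)) = (a * b) *: (x * z).
Proof. by rewrite -scalerAr scalerA. Qed.

(** The factor 1/2 cancels the doubling due to the symmetry. The term at 0 is kept apart as [u]
    because [h(0)] has a form of its own. *)
Lemma half_fsbig_int (F : fieldType) (V : lmodType F) (g : int -> V) u t N :
  2%:R != 0 :> F ->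
  (forall k : nat, g (Negz k) = g (Posz k)) ->
  g (Posz 0) = u ->
  (forall k : nat, g (Posz k.+1) = t k.+1) ->
  (forall k : nat, (N <= k.+1)%N -> g (Posz k.+1) = 0) ->
  2^-1 *: \sum_(k \in [set: int]) g k = u + \sum_(1 <= k < N) t k.
Proof.
move=> two0 gneg <- gt gN; rewrite (fsbig_int _ _ N.+1) //; last first.
  by case=> // k Nk; rewrite gN // ltnW.
rewrite -scaler_nat scalerA mulVf // scale1r big_nat_recl //; congr (_ + _).
rewrite big_add1; under [RHS]eq_bigr do rewrite -gt.
(* For positive [N] the left sum has one more term, [g] at [N], which vanishes. *)
case: N gN => [|N] gN; first by rewrite !big_geq.
by rewrite big_nat_recr //= gN // addr0.
Qed.

(** For evaluation at [y x_{k+1}], where only the derivative with the largest index in the sum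
    survives. *)
Lemma big_nat_eq_last (V : zmodType) (t : nat -> V) k :
  (forall j, (j < k)%N -> t j.+1 = 0) -> \sum_(1 <= j < k.+2) t j = t k.+1.
Proof. by move=> t0; rewrite big_nat_recr //= big_add1 big_nat big1 ?add0r. Qed.

(** A product of two monomials is again a monomial, with coefficient 1, so comparing that
    coefficient yields [a]. *)
Lemma scale_malgUM_inj (F : fieldType) (K : monomType) (a : F) (m1 m2 : K) :
  a *: (<< m1 >> * << m2 >>) = << m1 >> * << m2 >> :> {malg F[K]} -> a = 1.
Proof.
rewrite malgUM malgZU !mulr1 => /(congr1 (mcoeff (mmul m1 m2))).
by rewrite !mcoeffUU.
Qed.

(** * Explicit forms of the two operators *)

Section Expansion.
Context {F : fieldType}.
Implicit Types (f : polyYX F) (alpha beta : nat -> F).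

Lemma pderiv_vxMl i n f : i != n -> pderiv i (vx n * f) = vx n * pderiv i f.
Proof. by move=> /negPf ni; rewrite pderivM pderiv_vx ni mul0r add0r. Qed.

(* [Negz k] is [-1-k]. *)
Lemma Lm1_term_sym alpha beta f (k : nat) :
  heis alpha beta (-1 - Negz k) (heis alpha beta (Negz k) f)
  = heis alpha beta (-1 - Posz k) (heis alpha beta (Posz k) f).
Proof.
case: k => [|k].
  (* The modes paired are 0 and -1 here, [k+1] and [-k-2] below. They involve different variables,
     so the derivative passes through the multiplication. *)
  rewrite [heis _ _ (Negz 0) _]/= [LHS]/= pderivZ pderiv_vxMl; last by [].
  exact: (@mulr_scaleCA F (polyYX F)).
rewrite [LHS]/= pderivZ pderiv_vxMl; last by rewrite ltn_eqF.
exact: (@scale_mulrCA F (polyYX F)).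
Qed.

Lemma Lm1_term0 alpha beta f :
  heis alpha beta (-1 - Posz 0) (heis alpha beta (Posz 0) f)
  = alpha 1%N *: (vx 1 * (vy * pderiv 0 f)).
Proof. by []. Qed.

Lemma Lm1_termS alpha beta f (k : nat) :
  heis alpha beta (-1 - Posz k.+1) (heis alpha beta (Posz k.+1) f)
  = (alpha k.+2 * beta k.+1) *: (vx k.+2 * pderiv k.+1 f).
Proof. exact: (@scale_mulr_scale F (polyYX F)). Qed.

(** The bound [N] stays free so that it can be fitted to each test vector: 1 for [y], [k+2] for
    [y x_{k+1}]. *)
Lemma Lm1E alpha beta f N : 2%:R != 0 :> F ->
  (forall k, (N <= k)%N -> pderiv k f = 0) ->
  Lm1 alpha beta f = alpha 1%N *: (vx 1 * (vy * pderiv 0 f))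
    + \sum_(1 <= k < N) (alpha k.+1 * beta k) *: (vx k.+1 * pderiv k f).
Proof.
move=> two0 fN; apply: (@half_fsbig_int F (polyYX F) _ _ _ N two0).
- exact: Lm1_term_sym.
- exact: Lm1_term0.
- exact: Lm1_termS.
by move=> k Nk; rewrite [heis _ _ (Posz k.+1) _]/= (fN k.+1 Nk) scaler0 heis0.
Qed.

Lemma calDE f N : (forall k, (N <= k)%N -> pderiv k f = 0) ->
  calD f = vx 1 * (vy * pderiv 0 f)
    + \sum_(1 <= k < N) vx k.+1 * pderiv k f.
Proof.
move=> fN; apply: (@congr2 _ _ _ (@GRing.add (polyYX F))).
  exact/esym/(@mulrA (polyYX F)).
exact: (locfin_sumE (A := polyYX F) _ fN).
Qed.

(** * Evaluation at the test vectors [y] and [y x_{k+1}] *)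

Lemma scale_vxM_inj (a : F) i j :
  a *: (vx i * vx j) = vx i * vx j :> polyYX F -> a = 1.
Proof. exact: scale_malgUM_inj. Qed.

Lemma free_of_yU (m : cmonom nat) : m 0%N = 0%N ->
  free_of_y (<< m >> : polyYX F).
Proof. by move=> m0 m'; rewrite msuppU1 => /fset1P ->. Qed.

Lemma free_of_y1 : free_of_y (1 : polyYX F).
Proof. by apply: free_of_yU; rewrite onecmE. Qed.

Lemma free_of_y_vx n : free_of_y (vx n.+1 : polyYX F).
Proof. by apply: free_of_yU; rewrite ucmE. Qed.

Lemma pderiv_vxK n : pderiv n (vx n) = 1 :> polyYX F.
Proof. by rewrite pderiv_vx eqxx. Qed.

Lemma vx1M_euler_vy : vx 1 * (vy * pderiv 0 vy) = vx 1 * vy :> polyYX F.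
Proof. by rewrite pderiv_vxK; apply/(congr1 (@GRing.mul (polyYX F) _))/mulr1. Qed.

Lemma pderiv_vyvxK n : pderiv n.+1 (vy * vx n.+1) = vy :> polyYX F.
Proof. by rewrite pderiv_vxMl // pderiv_vxK (@mulr1 (polyYX F)). Qed.

Lemma pderiv_vyvx0 i n : i.+1 != n -> pderiv i.+1 (vy * vx n) = 0 :> polyYX F.
Proof.
move=> /negPf ni; rewrite pderiv_vxMl // pderiv_vx ni.
exact: (@mulr0 (polyYX F)).
Qed.

Lemma Lm1_eq_calD alpha beta : 2%:R != 0 :> F ->
  (forall f, yFx f -> Lm1 alpha beta f = calD f) <->
  alpha 1%N = 1 /\ forall k, (1 <= k)%N -> alpha k.+1 * beta k = 1.
Proof.
move=> two0; split=> [LD|[a1 ab] f _]; last first.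
  have [N fN] := pderiv_bound f.
  rewrite (Lm1E _ _ _ _ two0 fN) (calDE _ _ fN) a1 scale1r.
  apply: (@congr2 _ _ _ (@GRing.add (polyYX F)) _ _ _ _ erefl).
  by apply: eq_big_nat => k /andP[k1 _]; rewrite ab // scale1r.
(* At [y] both sums are empty, leaving [alpha(1) x_1 y = x_1 y]. Since [vy] is [vx 0],
   [scale_vxM_inj] applies with indices 1 and 0. *)
have a1 : alpha 1%N = 1.
  have yN k : (1 <= k)%N -> pderiv k (vy : polyYX F) = 0.
    by case: k => // k _; rewrite pderiv_vx.
  have := LD (vy * 1) (imageP _ free_of_y1).
  rewrite (@mulr1 (polyYX F)) (Lm1E _ _ _ _ two0 yN) (calDE _ _ yN).
  rewrite !big_geq // !addr0 vx1M_euler_vy; exact: (@scale_vxM_inj _ 1 0).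
split=> // -[//|k] _.
(* At [y x_{k+1}] the [x_1] terms cancel by [a1], and each sum reduces to its last term, a multiple
   of [x_{k+2} y]. *)
have yxN j : (k.+2 <= j)%N -> pderiv j (vy * vx k.+1 : polyYX F) = 0.
  by case: j => // j kj; rewrite pderiv_vyvx0 ?gtn_eqF.
have := LD (vy * vx k.+1) (imageP _ (free_of_y_vx k)).
rewrite (Lm1E _ _ _ _ two0 yxN) (calDE _ _ yxN) a1 scale1r.
move=> /(@addrI (polyYX F)).
rewrite !(@big_nat_eq_last (polyYX F)) ?pderiv_vyvxK; first exact: scale_vxM_inj.
  by move=> j jk; rewrite pderiv_vyvx0 ?ltn_eqF // (@mulr0 (polyYX F)).
by move=> j jk; rewrite pderiv_vyvx0 ?ltn_eqF // (@mulr0 (polyYX F)) scaler0.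
Qed.

(** * Solving the recursion for the constants *)

Lemma heis_constantsP alpha beta : (forall n, (1 <= n)%N -> n%:R != 0 :> F) ->
  (forall n, (1 <= n)%N -> alpha n * beta n = n%:R) ->
  alpha 1%N = 1 /\ (forall k, (1 <= k)%N -> alpha k.+1 * beta k = 1) <->
  (forall n, (1 <= n)%N ->
     alpha n = 1 / ((n - 1)`!)%:R /\ beta n = (n`!)%:R).
Proof.
move=> n0 ab; have fact0 n : (n`!)%:R != 0 :> F by rewrite n0 ?fact_gt0.
(* Divide [alpha(n+1) beta(n+1) = n+1] by [alpha(n+1) = 1/n!]. *)
have betaE n : alpha n.+1 = 1 / (n`!)%:R -> beta n.+1 = (n.+1`!)%:R.
  move=> an; have := ab n.+1 isT; rewrite an div1r factS natrM => <-.
  by rewrite mulrAC mulVf ?mul1r.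
split=> [[a1 aS]|aE]; last first.
  split; first by have [-> _] := aE 1%N isT; rewrite divr1.
  move=> k k1; have [-> _] := aE k.+1 isT; have [_ ->] := aE k k1.
  by rewrite subn1 div1r mulVf.
suff aE n : alpha n.+1 = 1 / (n`!)%:R.
  by case=> // n _; rewrite subn1 (betaE n).
elim: n => [|n IHn]; first by rewrite divr1.
(* The induction hypothesis gives [beta(n+1) = (n+1)!], which [aS] makes the inverse of
   [alpha(n+2)]. *)
apply: (mulIf (fact0 n.+1)).
by rewrite divfK // -(betaE n IHn) aS.
Qed.

End Expansion.

(* R[i] is the field of complex numbers over the real numbers R. *)
Theorem proposition6p1 (R : realType) (alpha beta : nat -> R[i])
    (alpha_beta : forall n : nat, (1 <= n)%N -> alpha n * beta n = n%:R) :
  (forall f : polyYX R[i], yFx f -> Lm1 alpha beta f = calD f) <->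
  (forall n : nat, (1 <= n)%N ->
     alpha n = 1 / ((n - 1)`!)%:R /\ beta n = (n`!)%:R).
Proof.
(* Characteristic zero makes 2 and all factorials invertible. *)
have n0 n : (1 <= n)%N -> n%:R != 0 :> R[i].
  by rewrite Num.Theory.pnatr_eq0 -lt0n.
rewrite -(heis_constantsP _ _ n0 alpha_beta).
exact: (Lm1_eq_calD _ _ (n0 2 isT)).
Qed.
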